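(* Let $\mathscr{F}$ be a free filter on $\mathbb{N}$ and let $F\in\mathscr{F}$ be a set with infinite complement $\mathbb{N}\setminus F$. Then for each infinite cardinal $\lambda$ the following statements hold: (i) the closed subsemilattice $E=\left(\mathbb{N}_{\mathscr{F},\max}\times\{0\}\right)\cup\left((\mathbb{N}\setminus F)\times\lambda\right)$ of the direct product $\mathbb{N}_{\mathscr{F},\max}\times E_{\lambda}$ is $\mathscr{H}$-complete; (ii) for each subset $\kappa\subset\lambda$ the subset $I_{\kappa}=\left(\mathbb{N}_{\mathscr{F},\max}\times\{0\}\right)\cup\left((\mathbb{N}\setminus F)\times\kappa\right)$ is an open-and-closed ideal in $E$, and the quotient semilattice $E/I_{\kappa}$ with the quotient topology is discrete and not $\mathscr{H}$-complete; (iii) the semilattice $E$ is not $\mathscr{AH}$-complete.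
   Context: All topological spaces are assumed to be Hausdorff. $\mathbb{N}$ is the set of positive integers. A topological semigroup is a (Hausdorff) topological space with a continuous (jointly, as a map $S\times S\to S$) associative operation. A semilattice is a set with a commutative, idempotent, associative operation; a topological semilattice is a topological semigroup which is algebraically a semilattice. A topological semigroup $X$ is $\mathscr{H}$-complete if for every Hausdorff topological semigroup $Y$ and every homomorphism $f\colon X\to Y$ that is a topological embedding, $f(X)$ is closed in $Y$. $X$ is $\mathscr{AH}$-complete if for every Hausdorff topological semigroup $Y$ and every continuous homomorphism $f\colon X\to Y$, $f(X)$ is closed in $Y$. A (proper) filter $\mathscr{F}$ on $\mathbb{N}$ is free if $\bigcap\mathscr{F}=\varnothing$. For a free filter $\mathscr{F}$ on $\mathbb{N}$, $\mathbb{N}_{\mathscr{F}}=\mathbb{N}\cup\{\mathscr{F}\}$ is the topological space in which all points of $\mathbb{N}$ are isolated and the sets $F\cup\{\mathscr{F}\}$, $F\in\mathscr{F}$, form a neighbourhood base at the point $\mathscr{F}$. $\mathbb{N}_{\mathscr{F},\max}$ is the topological semilattice on this space whose operation extends $\max$ on $\mathbb{N}$ by $\max\{n,\mathscr{F}\}=\max\{\mathscr{F},n\}=\max\{\mathscr{F},\mathscr{F}\}=\mathscr{F}$ for $n\in\mathbb{N}$. For an infinite cardinal $\lambda$, regarded as a set of cardinality $\lambda$ with $0\notin\lambda$ (so $0$ is an extra point), $E_\lambda=\{0\}\cup\lambda$ is the discrete topological semilattice with operation $x\cdot y=x$ if $x=y$ and $x\cdot y=0$ if $x\neq y$. Direct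 products carry the coordinatewise operation and the product topology; subsemilattices carry the subspace topology. For an ideal $I$ of $E$ (that is, a nonempty set with $I\cdot E\subseteq I$), $E/I$ is the Rees quotient, obtained from $E$ by collapsing $I$ to a single point (the zero of $E/I$).
   Formalization: In (ii) the subset κ is taken to be a proper subset of λ: for κ = λ the ideal I_κ is all of E, so E/I_κ is a one-point semilattice, which is H-complete, and the claim fails. *)

(* Defs.v *)
From HB Require Import structures.
From mathcomp Require Import all_boot all_classical topology.

Set Implicit Arguments.
Unset Strict Implicit.
Unset Printing Implicit Defensive.

Local Open Scope classical_set_scope.
Local Open Scope group_scope.
Local Open Scope quotient_scope.

HB.mixin Record Semigroup_isSemilattice G of Semigroup G := {
  semilattice_mulC : commutative (@mul G);
  semilattice_mulxx : idempotent_op (@mul G)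
}.

#[short(type="semilatticeType")]
HB.structure Definition Semilattice :=
  {G of Semigroup_isSemilattice G & Semigroup G}.

(* The "Pre" structures carry an operation and a topology with no compatibility
   between them; compatibility is the predicate [topological_semigroup]. *)
#[short(type="preTopologicalSemigroupType")]
HB.structure Definition PreTopologicalSemigroup :=
  {G of Topological G & Semigroup G}.

#[short(type="preTopologicalSemilatticeType")]
HB.structure Definition PreTopologicalSemilattice :=
  {G of Topological G & Semilattice G}.

Definition topological_semigroup (X : preTopologicalSemigroupType) : Prop :=
  hausdorff_space X /\ continuous (fun p : X * X => p.1 * p.2).

Definition topological_embedding (X Y : topologicalType) (f : X -> Y) : Prop :=
  [/\ injective f, continuous f &
    forall U : set X, open U ->
      exists2 V : set Y, open V & f @` U = V `&` range f].

Definition discrete_space (X : topologicalType) : Prop :=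
  forall U : set X, open U.

(* Both completeness notions are meant for an [X] that is itself a
   topological semigroup. *)
Definition H_complete (X : preTopologicalSemigroupType) : Prop :=
  forall Y : preTopologicalSemigroupType, topological_semigroup Y ->
  forall f : X -> Y, {morph f : x y / x * y} -> topological_embedding f ->
  closed (range f).

Definition AH_complete (X : preTopologicalSemigroupType) : Prop :=
  forall Y : preTopologicalSemigroupType, topological_semigroup Y ->
  forall f : X -> Y, {morph f : x y / x * y} -> continuous f ->
  closed (range f).

Section DirectProduct.
Context (X Y : semilatticeType).
Implicit Types p q : X * Y.

Definition prod_mul p q : X * Y := (p.1 * q.1, p.2 * q.2).

Lemma prod_mulA : associative prod_mul.
Proof. by move=> p q r; rewrite /prod_mul /= !mulgA. Qed.

Lemma prod_mulC : commutative prod_mul.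
Proof.
by move=> p q; rewrite /prod_mul (semilattice_mulC p.1) (semilattice_mulC p.2).
Qed.

Lemma prod_mulxx : idempotent_op prod_mul.
Proof. by case=> x y; rewrite /prod_mul /= !semilattice_mulxx. Qed.

HB.instance Definition _ := isSemigroup.Build (X * Y)%type prod_mulA.
HB.instance Definition _ :=
  Semigroup_isSemilattice.Build (X * Y)%type prod_mulC prod_mulxx.
End DirectProduct.

Definition ideal (S : semilatticeType) (I : set S) : Prop :=
  I !=set0 /\ forall x y : S, I x -> I (x * y).

Section ReesQuotient.
Context (S : preTopologicalSemilatticeType) (I : set S).

Definition rees_rel (x y : S) : bool := (x == y) || (x \in I) && (y \in I).

Lemma rees_rel_refl : reflexive rees_rel.
Proof. by move=> x; rewrite /rees_rel eqxx. Qed.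

Lemma rees_rel_sym : symmetric rees_rel.
Proof. by move=> x y; rewrite /rees_rel eq_sym andbC. Qed.

Lemma rees_rel_trans : transitive rees_rel.
Proof.
move=> y x z /orP[/eqP->//|/andP[xI yI]] /orP[/eqP<-|/andP[_ zI]].
  by rewrite /rees_rel xI yI orbT.
by rewrite /rees_rel xI zI orbT.
Qed.

Canonical rees_equiv :=
  EquivRel rees_rel rees_rel_refl rees_rel_sym rees_rel_trans.

(* The proof argument makes the operation on the quotient well defined. *)
Definition rees_quotient (_ : ideal I) : Type :=
  quotient_topology {eq_quot rees_equiv}.

Variable idI : ideal I.
Local Notation Q := (rees_quotient idI).

HB.instance Definition _ :=
  Topological.copy Q (quotient_topology {eq_quot rees_equiv}).
HB.instance Definition _ :=
  Quotient.copy Q (quotient_topology {eq_quot rees_equiv}).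

Definition rees_mul (x y : Q) : Q := \pi_Q (repr x * repr y).

Lemma rees_piP (x y : S) : reflect (\pi_Q x = \pi_Q y) (rees_rel x y).
Proof. exact: (@eqmodP _ rees_equiv). Qed.

Lemma rees_mul_pi (x y : S) : rees_mul (\pi_Q x) (\pi_Q y) = \pi_Q (x * y).
Proof.
have idM u v : u \in I -> (u * v \in I) /\ (v * u \in I).
  move=> /set_mem Iu; rewrite (semilattice_mulC v).
  by split; apply/mem_set; apply: idI.2.
have /rees_piP /orP xE : \pi_Q (repr (\pi_Q x)) = \pi_Q x by rewrite reprK.
have /rees_piP /orP yE : \pi_Q (repr (\pi_Q y)) = \pi_Q y by rewrite reprK.
apply/rees_piP/orP.
case: xE => [/eqP->|/andP[rI xI]]; last first.
  by right; rewrite (idM _ _ rI).1 (idM _ _ xI).1.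
case: yE => [/eqP->|/andP[rI yI]]; first by left.
by right; rewrite (idM _ _ rI).2 (idM _ _ yI).2.
Qed.

Lemma rees_mulA : associative rees_mul.
Proof.
elim/quotW=> x; elim/quotW=> y; elim/quotW=> z.
by rewrite (rees_mul_pi y) (rees_mul_pi x y) (rees_mul_pi x) rees_mul_pi mulgA.
Qed.

Lemma rees_mulC : commutative rees_mul.
Proof. by move=> x y; rewrite /rees_mul semilattice_mulC. Qed.

Lemma rees_mulxx : idempotent_op rees_mul.
Proof. by move=> x; rewrite /rees_mul semilattice_mulxx reprK. Qed.

HB.instance Definition _ := isSemigroup.Build Q rees_mulA.
HB.instance Definition _ :=
  Semigroup_isSemilattice.Build Q rees_mulC rees_mulxx.
End ReesQuotient.

Definition posnat : Type := {n : nat | (0 < n)%N}.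
HB.instance Definition _ := SubCountable.copy posnat {n : nat | (0 < n)%N}.

Lemma pmax_subproof (m n : posnat) : (0 < maxn (val m) (val n))%N.
Proof. by rewrite leq_max (valP m). Qed.

Definition pmax (m n : posnat) : posnat :=
  exist (fun k : nat => (0 < k)%N) (maxn (val m) (val n)) (pmax_subproof m n).

Definition free_filter (F : pfilter_on posnat) : Prop :=
  \bigcap_(B in (F : set_system posnat)) B = set0.

(* [Some n] is the isolated point n and [None] is the point F. *)
Definition NFmax (_ : pfilter_on posnat) : Type := option posnat.

Section FilterSemilattice.
Variable F : pfilter_on posnat.
Local Notation NF := (NFmax F).

HB.instance Definition _ := Choice.copy NF (option posnat).

Definition NF_open (U : set NF) : Prop := U None -> F (Some @^-1` U).

Lemma NF_openT : NF_open setT.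
Proof. by move=> _; exact: filterT. Qed.

Lemma NF_openI : setI_closed NF_open.
Proof. by move=> U V oU oV [/oU FU /oV FV]; exact: filterI. Qed.

Lemma NF_open_bigU (J : Type) (U : J -> set NF) :
  (forall j, NF_open (U j)) -> NF_open (\bigcup_j U j).
Proof.
move=> oU [j _ /oU FU]; apply: filterS FU => n Un; by exists j.
Qed.

HB.instance Definition _ :=
  isOpenTopological.Build NF NF_openT NF_openI NF_open_bigU.

Definition NF_mul (x y : NF) : NF :=
  match x, y with
  | Some m, Some n => Some (pmax m n)
  | _, _ => None
  end.

Lemma NF_mulA : associative NF_mul.
Proof.
by case=> [m|] [n|] [p|] //=; congr Some; apply: val_inj; rewrite /= maxnA.
Qed.

Lemma NF_mulC : commutative NF_mul.
Proof. by case=> [m|] [n|] //=; congr Some; apply: val_inj; rewrite /= maxnC. Qed.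

Lemma NF_mulxx : idempotent_op NF_mul.
Proof. by case=> [m|] //=; congr Some; apply: val_inj; rewrite /= maxnn. Qed.

HB.instance Definition _ := isSemigroup.Build NF NF_mulA.
HB.instance Definition _ :=
  Semigroup_isSemilattice.Build NF NF_mulC NF_mulxx.
End FilterSemilattice.

Section DiscreteSemilattice.
Variable L : choiceType.

(* [None] is the zero. *)
Definition Elam : Type := discrete_topology (option L).
HB.instance Definition _ :=
  DiscreteTopology.copy Elam (discrete_topology (option L)).

Definition Elam_mul (x y : Elam) : Elam := if x == y then x else None.

Lemma Elam_mulA : associative Elam_mul.
Proof.
have mulN (x : Elam) : Elam_mul x None = None.
  by rewrite /Elam_mul; case: eqP.
have Nmul (x : Elam) : Elam_mul None x = None.
  by rewrite /Elam_mul; case: eqP.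
move=> x y z; rewrite {2}/Elam_mul.
case: (eqVneq y z) => [<-|yz].
  rewrite {3}/Elam_mul; case: eqVneq => [->//|xy].
  by rewrite Nmul /Elam_mul (negbTE xy).
rewrite mulN {2}/Elam_mul; case: eqVneq => [->|xy]; last by rewrite Nmul.
by rewrite /Elam_mul (negbTE yz).
Qed.

Lemma Elam_mulC : commutative Elam_mul.
Proof. by move=> x y; rewrite /Elam_mul eq_sym; case: eqP => [->|]. Qed.

Lemma Elam_mulxx : idempotent_op Elam_mul.
Proof. by move=> x; rewrite /Elam_mul eqxx. Qed.

HB.instance Definition _ := isSemigroup.Build Elam Elam_mulA.
HB.instance Definition _ :=
  Semigroup_isSemilattice.Build Elam Elam_mulC Elam_mulxx.
End DiscreteSemilattice.

Section SubsemilatticeE.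
Variables (F : pfilter_on posnat) (A : set posnat) (L : choiceType).

(* (N_F,max x {0}) `|` ((N \ A) x K); it is the carrier of E for K = L and
   that of the ideal I_K in general. *)
Definition layer_set (K : set L) : set (NFmax F * Elam L) :=
  ([set: NFmax F] `*` [set None]) `|` ((Some @` (~` A)) `*` (Some @` K)).

Definition E_set : set (NFmax F * Elam L) := layer_set [set: L].

Lemma E_mulg_closed : mulg_closed (mem E_set : {pred NFmax F * Elam L}).
Proof.
move=> [x a] [y b] /set_mem Exa /set_mem Eyb; apply/mem_set => /=.
case: Exa => [[_ /= ->]|[[n /= An <-] [k _ /= <-]]].
  by left; split=> //=; rewrite /mul /= /Elam_mul; case: eqP.
case: Eyb => [[_ /= ->]|[[m /= Am <-] [l _ /= <-]]]; first by left.
have [->|kl] := eqVneq k l; last first.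
  by left; split=> //=; rewrite /mul /= /Elam_mul (inj_eq Some_inj) (negbTE kl).
right; split; last first.
  by exists l => //=; rewrite /mul /= /Elam_mul eqxx.
have [mn|nm] := leqP (val m) (val n).
  exists n => //=; congr Some; apply: val_inj => /=.
  by rewrite (maxn_idPl mn).
exists m => //=; congr Some; apply: val_inj => /=.
by rewrite (maxn_idPr (ltnW nm)).
Qed.

Definition E_type : Type := set_type E_set.
HB.instance Definition _ := Topological.copy E_type (set_type E_set).
HB.instance Definition _ := SubChoice.copy E_type (set_type E_set).
HB.instance Definition _ :=
  SubChoice_isSubSemigroup.Build _ _ E_type E_mulg_closed.

Lemma E_mulC : commutative (@mul E_type).
Proof. by move=> x y; apply: val_inj; rewrite !gmulfM semilattice_mulC. Qed.

Lemma E_mulxx : idempotent_op (@mul E_type).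
Proof. by move=> x; apply: val_inj; rewrite gmulfM semilattice_mulxx. Qed.

HB.instance Definition _ := Semigroup_isSemilattice.Build E_type E_mulC E_mulxx.

Definition I_set (K : set L) : set E_type := val @^-1` layer_set K.
End SubsemilatticeE.

Arguments layer_set : clear implicits.
Arguments E_set : clear implicits.
Arguments I_set : clear implicits.

(* Main.v *)
(* Completeness of E: suppose f(E) embeds in Y and y is a limit of f(E) outside
   f(E). If y is a limit of the layer N_F x {0}, then y f(n, 0) = y for all n,
   while f(n, 0) clusters at f(F, 0), so y = y f(F, 0) = f(F, 0). If y is a limit
   of a single layer (N \ A) x {l}, then y f(1, 0) is a limit of (N \ A) x {0},
   hence lies in f(N_F x {0}), although no tail of N \ A accumulates there, A
   being in F. Otherwise points near y lie in two different layers, whose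
   products lie in N_F x {0}, so y = y y is a limit of that layer.

   Incompleteness of E / I_K: for l outside K, the copy of (N \ A) x {l} is an
   omega-chain in a discrete semilattice, and one may adjoin a limit point to
   it. Composing with E -> E / I_0 for K empty gives a continuous homomorphism
   of E with non-closed image. *)

Require Import Defs.
From HB Require Import structures.
From mathcomp Require Import all_boot all_classical topology.

Set Implicit Arguments.
Unset Strict Implicit.
Unset Printing Implicit Defensive.

Local Open Scope classical_set_scope.
Local Open Scope group_scope.
Local Open Scope quotient_scope.

(** * Open-set criteria for closures, products, separation and continuity *)

Section OpenSets.
Context {X : topologicalType}.

Lemma closureP (B : set X) (x : X) :
  closure B x <-> forall U, open U -> U x -> exists2 b, B b & U b.
Proof.
split=> [clB U oU Ux|H V /=].
  by have [b [Bb Ub]] := clB U (open_nbhs_nbhs (conj oU Ux)); exists b.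
rewrite nbhsE => -[U [oU Ux] UV].
by have [b Bb Ub] := H U oU Ux; exists b; split=> //; exact: UV.
Qed.

Lemma prod_openP (Y : topologicalType) (U : set (X * Y)) :
  open U <-> forall x y, U (x, y) -> exists (V : set X) (W : set Y),
    [/\ open V, open W, V x, W y & forall a b, V a -> W b -> U (a, b)].
Proof.
split=> [oU x y Uxy|H].
  have [[P Q] [/= Px Qy] PQ] := open_nbhs_nbhs (conj oU Uxy).
  move: Px Qy; rewrite !nbhsE => -[V [oV Vx] VP] [W [oW Wy] WQ].
  exists V, W; split=> // a b /VP Pa /WQ Qb; exact: (PQ (a, b)).
rewrite openE => -[x y] /H[V [W [oV oW Vx Wy VWU]]].
exists (V, W); first by split; exact: open_nbhs_nbhs.
by move=> [a b] [/= Va Wb]; exact: VWU.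
Qed.

Lemma open_setX (Y : topologicalType) (V : set X) (W : set Y) :
  open V -> open W -> open (V `*` W).
Proof. by move=> oV oW; apply/prod_openP => x y [Vx Wy]; exists V, W. Qed.

Lemma hausdorff_openP : hausdorff_space X <-> forall x y : X, x <> y ->
  exists U V : set X, [/\ open U, open V, U x, V y & U `&` V = set0].
Proof.
rewrite open_hausdorff; split=> H x y.
  move=> /eqP /H[[U V] [/= /set_mem Ux /set_mem Vy] [oU oV UV]].
  by exists U, V; split=> //; exact/eqP.
move=> /eqP /H[U [V [oU oV Ux Vy UV]]].
by exists (U, V) => /=; split=> //; [exact/mem_set|exact/mem_set|exact/eqP].
Qed.

End OpenSets.

Lemma mul_continuousP (X : preTopologicalSemigroupType) :
  continuous (fun p : X * X => p.1 * p.2) <->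
  forall x y (U : set X), open U -> U (x * y) -> exists V W : set X,
    [/\ open V, open W, V x, W y & forall a b, V a -> W b -> U (a * b)].
Proof.
rewrite continuousP; split=> [c x y U /c /prod_openP oU Uxy|H U oU].
  exact: (oU x y Uxy).
by apply/prod_openP => x y; exact: H.
Qed.

Lemma discrete_topological_semigroup (X : preTopologicalSemigroupType) :
  discrete_space X -> topological_semigroup X.
Proof.
move=> dX; split.
  apply/hausdorff_openP => x y xy; exists [set x], [set y].
  by split=> //; rewrite -subset0 => z [-> /xy].
apply/mul_continuousP => x y U _ Uxy; exists [set x], [set y].
by split=> // a b -> ->.
Qed.

Lemma hausdorff_equalizer (X Y : topologicalType) (g h : X -> Y) (B : set X) x :
  hausdorff_space Y -> continuous g -> continuous h ->
  (forall b, B b -> g b = h b) -> closure B x -> g x = h x.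
Proof.
move=> /hausdorff_openP hY /continuousP cg /continuousP ch gh clx.
apply: contrapT => /hY[U [V [oU oV Ux Vx UV]]].
have [b Bb [Ub Vb]] := (closureP B x).1 clx _ (openI (cg U oU) (ch V oV))
  (conj Ux Vx).
suff: (U `&` V) (g b) by rewrite UV.
by split=> //; rewrite gh.
Qed.

Lemma closure_image (X Y : topologicalType) (g : X -> Y) (B : set X)
    (C : set Y) x :
  continuous g -> (forall b, B b -> C (g b)) -> closure B x -> closure C (g x).
Proof.
move=> /continuousP cg gBC clx; apply/closureP => U oU Ugx.
have [b Bb Ugb] := (closureP B x).1 clx _ (cg U oU) Ugx.
by exists (g b) => //; exact: gBC.
Qed.

Lemma embedding_closure (X Y : topologicalType) (f : X -> Y) (B : set X) x :
  topological_embedding f -> closure (f @` B) (f x) -> closure B x.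
Proof.
move=> [injf _ openf] clx; apply/closureP => U /openf[V oV fUV] Ux.
have Vfx : V (f x) by have : (f @` U) (f x) by [exists x]; rewrite fUV => -[].
have [_ [b Bb <-] Vfb] := (closureP _ _).1 clx V oV Vfx.
exists b => //; have : (f @` U) (f b) by rewrite fUV; split=> //; exists b.
by move=> [a Ua /injf <-].
Qed.

(** * Translations and squaring in a topological semigroup *)

Section TopologicalSemigroup.
Context {Y : preTopologicalSemigroupType}.
Hypothesis tY : topological_semigroup Y.

Lemma mulr_continuous (a : Y) : continuous (fun y : Y => y * a).
Proof.
apply/continuousP => U oU; rewrite openE => y Uy; rewrite /interior nbhsE.
have [V [W [oV oW Vy Wa VW]]] := (mul_continuousP Y).1 tY.2 _ _ U oU Uy.
by exists V => // b Vb; exact: VW.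
Qed.

Lemma mull_continuous (a : Y) : continuous (fun y : Y => a * y).
Proof.
apply/continuousP => U oU; rewrite openE => y Uy; rewrite /interior nbhsE.
have [V [W [oV oW Va Wy VW]]] := (mul_continuousP Y).1 tY.2 _ _ U oU Uy.
by exists W => // b Wb; exact: VW.
Qed.

Lemma sqr_continuous : continuous (fun y : Y => y * y).
Proof.
apply/continuousP => U oU; rewrite openE => y Uy; rewrite /interior nbhsE.
have [V [W [oV oW Vy Wy VW]]] := (mul_continuousP Y).1 tY.2 _ _ U oU Uy.
by exists (V `&` W); [split=> //; exact: openI|move=> b [Vb Wb]; exact: VW].
Qed.

End TopologicalSemigroup.

Arguments mulr_continuous {Y} tY a.
Arguments mull_continuous {Y} tY a.
Arguments sqr_continuous {Y} tY.

(** * Adjoining a limit point to a descending chain *)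

(* In the semilattice order ([x <= y] iff [x * y = x]), [C] is an up-set and a
   chain that descends as [rank] grows. *)
Record prime_chain (S : semilatticeType) (C : set S) (rank : S -> nat) (z : S)
    : Prop := PrimeChain {
  chain_prime : forall a b, C (a * b) <-> C a /\ C b;
  chain_mul : forall a b, C a -> C b -> (rank a <= rank b)%N -> a * b = b;
  chain_off : forall a b, C a -> ~ C b -> a * b = z;
  chain_zeroN : ~ C z;
  chain_zero : forall a, a * z = z;
  chain_unbounded : forall n, exists2 c, C c & (n <= rank c)%N }.

(* [None] is a new point, the limit of the chain. *)
Definition chain_limit (S : semilatticeType) (C : set S) rank z
  (_ : prime_chain C rank z) : Type := option S.

Section ChainLimit.
Context (S : semilatticeType) (C : set S) (rank : S -> nat) (z : S).
Hypothesis Cc : prime_chain C rank z.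
Local Notation T := (chain_limit Cc).

HB.instance Definition _ := Choice.copy T (option S).

(** Old points are isolated, and the tails of the chain together with the new point form a
    neighbourhood base at it. *)
Definition cl_open (U : set T) : Prop :=
  U None -> exists n, forall c, C c -> (n <= rank c)%N -> U (Some c).

Lemma cl_openT : cl_open setT.
Proof. by exists 0. Qed.

Lemma cl_openI : setI_closed cl_open.
Proof.
move=> U V oU oV [/oU[m Um] /oV[n Vn]]; exists (maxn m n) => c Cc'.
by rewrite geq_max => /andP[mc nc]; split; [exact: Um|exact: Vn].
Qed.

Lemma cl_open_bigU (J : Type) (U : J -> set T) :
  (forall j, cl_open (U j)) -> cl_open (\bigcup_j U j).
Proof.
by move=> oU [j _ /oU[n Un]]; exists n => c Cc' nc; exists j => //; exact: Un.
Qed.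

HB.instance Definition _ :=
  isOpenTopological.Build T cl_openT cl_openI cl_open_bigU.

(** This is the limit of [a * c] as [c] runs down the chain: eventually [a * c = c] if [a] is in
    [C], and always [a * c = z] otherwise. *)
Definition cl_act (a : S) : T := if `[< C a >] then None else Some z.

Definition cl_mul (x y : T) : T :=
  match x, y with
  | Some a, Some b => Some (a * b)
  | None, None => None
  | Some a, None | None, Some a => cl_act a
  end.

Lemma cl_actN a : ~ C a -> cl_act a = Some z.
Proof. by move=> /asboolPn/negPf; rewrite /cl_act => ->. Qed.

Lemma cl_actC a : C a -> cl_act a = None.
Proof. by rewrite /cl_act => /asboolP ->. Qed.

Lemma cl_mulC : commutative cl_mul.
Proof. by case=> [a|] [b|] //=; rewrite semilattice_mulC. Qed.

(** By primality of [C] and absorption by [z], [cl_act] is compatible with products. Every triple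
    containing the new point reduces to this. *)
Lemma cl_mulA : associative cl_mul.
Proof.
have [pr _ _ Nz z0 _] := Cc.
have zl a : z * a = z by rewrite semilattice_mulC z0.
have act_mul a b : cl_act (a * b) = cl_mul (Some a) (cl_act b).
  have [Cb|Nb] := EM (C b); last first.
    by rewrite (cl_actN Nb) /= z0 cl_actN// => /pr[].
  rewrite (cl_actC Cb) /=; have [Ca|Na] := EM (C a).
    by rewrite !cl_actC //; exact/pr.
  by rewrite !cl_actN // => /pr[].
have act_act a : cl_act a = cl_mul None (cl_act a).
  have [Ca|Na] := EM (C a); first by rewrite cl_actC.
  by rewrite !cl_actN //= cl_actN.
have act_mulC a b : cl_act (a * b) = cl_mul (cl_act a) (Some b).
  by rewrite semilattice_mulC act_mul cl_mulC.
case=> [a|] [b|] [c|] //.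
- by rewrite /= mulgA.
- by rewrite -[RHS]/(cl_act (a * b)) act_mul.
- by rewrite -[LHS]/(cl_mul (Some a) (cl_act c)) -act_mul act_mulC.
- by rewrite [RHS]cl_mulC -[RHS]/(cl_mul None (cl_act a)) -act_act.
- by rewrite -[LHS]/(cl_act (b * c)) act_mulC.
- by rewrite -[LHS]/(cl_mul None (cl_act c)) -act_act.
Qed.

HB.instance Definition _ := isSemigroup.Build T cl_mulA.

Lemma chain_limit_image_open (U : set S) : open (Some @` U : set T).
Proof. by rewrite -[open _]/(cl_open _) => -[]. Qed.

Lemma chain_limit_topological_semigroup : topological_semigroup T.
Proof.
have [pr mx off Nz z0 _] := Cc.
pose tail n : set T := [set None] `|` (Some @` [set c | C c /\ (n <= rank c)%N]).
have otail n : open (tail n).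
  by move=> _; exists n => c ? ?; right; exists c.
split.
  have sep (a : S) : exists U V : set T,
      [/\ open U, open V, U (Some a), V None & U `&` V = set0].
    (* Starting one past [rank a] excludes [a] from the tail, whether or not [a] lies in [C]. *)
    exists [set Some a], (tail (rank a).+1); split=> //.
    - by left.
    - by rewrite -subset0 => x [-> [//|[c [_ +] [ca]]]]; rewrite ca ltnn.
  apply/hausdorff_openP => -[a|] [b|] //.
  - move=> ab; exists [set Some a], [set Some b].
    split=> //.
    by rewrite -subset0 => x [-> /ab].
  - by move=> _; have [U [V [oU oV Ua Vb UV]]] := sep b; exists V, U; rewrite setIC.
have mulNS (b : S) (U : set T) : open U -> U (cl_act b) ->
  exists2 V : set T, open V /\ V None & forall x, V x -> U (cl_mul x (Some b)).
  move=> oU; have [Cb|Nb] := EM (C b).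
    rewrite cl_actC // => UN; have [n Un] := oU UN.
    (* Beyond [rank b] multiplication by [b] fixes the chain; beyond [n] the chain lies in [U]. *)
    exists (tail (maxn n (rank b))); first by split=> //; left.
    move=> x [->|[c [Cc' +] <-]] /=; first by rewrite cl_actC.
    rewrite geq_max => /andP[nc bc].
    by rewrite semilattice_mulC mx //; exact: Un.
  rewrite cl_actN // => Uz.
  exists (tail 0); first by split=> //; left.
  by move=> x [->|[c [Cc' _] <-]] /=; [rewrite cl_actN|rewrite off].
apply/mul_continuousP => -[a|] [b|] U oU Uxy.
- exists [set Some a], [set Some b].
  by split=> // _ _ -> ->.
- have [V [oV VN] VU] := mulNS a U oU Uxy; exists [set Some a], V.
  split=> //.
  by move=> _ x -> /VU; rewrite cl_mulC.
- have [V [oV VN] VU] := mulNS b U oU Uxy; exists V, [set Some b].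
  split=> //.
  by move=> x _ + -> => /VU.
- have [n Un] := oU Uxy; exists (tail n), (tail n); split=> //; [by left|by left|].
  have act c : C c -> U (cl_act c) by move=> Ccc; rewrite cl_actC.
  move=> _ _ [->|[c [Cc' nc] <-]] [->|[d [Cd nd] <-]] //; try exact: act.
  have [cd|/ltnW dc] := leqP (rank c) (rank d).
    by rewrite /mul /= mx //; exact: Un.
  by rewrite /mul /= semilattice_mulC mx //; exact: Un.
Qed.

Lemma chain_limit_closureN : closure (range (Some : S -> T)) None.
Proof.
have [_ _ _ _ _ ub] := Cc; apply/closureP => U oU /oU[n Un].
by have [c Cc' nc] := ub n; exists (Some c); [exists c|exact: Un].
Qed.

End ChainLimit.

(** [Some] embeds the discrete [S] as an open discrete subspace of [chain_limit], and the new point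
    lies in the closure of its range since ranks are unbounded. *)
Lemma prime_chain_not_closed (S : preTopologicalSemilatticeType) (C : set S)
    rank z :
  discrete_space S -> prime_chain C rank z ->
  exists Y : preTopologicalSemigroupType, topological_semigroup Y /\
    exists f : S -> Y, [/\ {morph f : x y / x * y}, topological_embedding f &
      ~ closed (range f)].
Proof.
move=> dS Cc; exists (chain_limit Cc); split.
  exact: chain_limit_topological_semigroup.
exists Some; split=> //; last first.
  by move=> cl; have [] := cl None (@chain_limit_closureN _ _ _ _ Cc).
split; [exact: Some_inj|by apply/continuousP => U _; exact: dS|].
move=> U _; exists (Some @` U : set (chain_limit Cc)).
  exact: chain_limit_image_open.
rewrite eqEsubset; split=> x [] //.
by move=> a Ua <-; split; exists a.
Qed.

(** * Products of topological semilattices *)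

HB.instance Definition _ (X Y : preTopologicalSemilatticeType) :=
  Semigroup.on (X * Y)%type.

Lemma prod_topological_semigroup (X Y : preTopologicalSemilatticeType) :
  topological_semigroup X -> topological_semigroup Y ->
  topological_semigroup (X * Y)%type.
Proof.
move=> [/hausdorff_openP hX /mul_continuousP cX].
move=> [/hausdorff_openP hY /mul_continuousP cY]; split.
  apply/hausdorff_openP => -[x y] [x' y'].
  have [<-|xx' _] := EM (x = x').
    have [<-//|yy' _] := EM (y = y').
    have [U [V [oU oV Uy Vy UV]]] := hY _ _ yy'.
    exists (setT `*` U), (setT `*` V); split=> //.
    - by apply: open_setX => //; exact: openT.
    - by apply: open_setX => //; exact: openT.
    - by rewrite -setXI UV setX0.
  have [U [V [oU oV Ux Vx UV]]] := hX _ _ xx'.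
  exists (U `*` setT), (V `*` setT); split=> //.
  - by apply: open_setX => //; exact: openT.
  - by apply: open_setX => //; exact: openT.
  - by rewrite -setXI UV set0X.
apply/mul_continuousP => -[x y] [x' y'] U /prod_openP oU /oU.
move=> [V [W [oV oW Vxx' Wyy' VWU]]].
have [V1 [V2 [oV1 oV2 V1x V2x' V12]]] := cX _ _ _ oV Vxx'.
have [W1 [W2 [oW1 oW2 W1y W2y' W12]]] := cY _ _ _ oW Wyy'.
exists (V1 `*` W1), (V2 `*` W2); split=> //.
- exact: open_setX.
- exact: open_setX.
- move=> [a b] [a' b'] [/= Va Wb] [/= Va' Wb'].
  by apply: VWU; [exact: V12|exact: W12].
Qed.

(** * The topological semilattice on the positive integers with the filter as limit point *)

Section Filter.
Variable F : pfilter_on posnat.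
Hypothesis F_free : free_filter F.
Local Notation NF := (NFmax F).

Lemma NF_openE (U : set NF) : open U = (U None -> F (Some @^-1` U)).
Proof. by []. Qed.

Lemma free_filter_setC1 (n : posnat) : F (~` [set n]).
Proof.
have : ~ (\bigcap_(B in (F : set_system posnat)) B) n by rewrite F_free.
by apply: contra_notP => nF B FB; apply: contrapT => Bn; apply: nF;
  apply: filterS FB => m Bm mn; apply: Bn; rewrite -mn.
Qed.

(** Freeness puts complements of points into [F]; a tail is a finite intersection of these. *)
Lemma free_filter_tail (n : nat) : F [set m | (n <= val m)%N].
Proof.
elim: n => [|n IH]; first by apply: filterS filterT.
(* There is no point 0 to remove, so passing from bound 0 to bound 1 costs nothing. *)
have [n0|n0] := posnP n.
  by apply: filterS filterT => m _ /=; rewrite n0 (valP m).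
have FC := free_filter_setC1 (exist _ n n0).
apply: filterS (filterI IH FC) => m [/= nm mn].
rewrite ltn_neqAle nm andbT; apply/eqP => nE.
by apply: mn; apply: val_inj.
Qed.

Lemma NF_mul_maxl (m n : posnat) :
  (val n <= val m)%N -> @mul NF (Some m) (Some n) = Some m.
Proof. by move=> /maxn_idPl nm; congr Some; exact: val_inj. Qed.

Lemma NF_topological_semigroup : topological_semigroup NF.
Proof.
have oSome (n : posnat) : open ([set Some n] : set NF) by rewrite NF_openE.
have sep (n : posnat) : exists U V : set NF,
    [/\ open U, open V, U (Some n), V None & U `&` V = set0].
  exists [set Some n], (~` [set Some n]); split=> //.
    rewrite NF_openE => _; apply: filterS (free_filter_setC1 n).
    by move=> m mn [].
  by rewrite setICr.
split.
  apply/hausdorff_openP => -[m|] [n|] //.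
  - move=> mn; exists [set Some m], [set Some n]; split=> //.
    by rewrite -subset0 => x [-> /mn].
  - move=> _; have [U [V [oU oV Ua Vb UV]]] := sep n.
    by exists V, U; rewrite setIC.
have mulNS (n : posnat) (U : set NF) : open U -> U None ->
    exists2 V : set NF, open V /\ V None & forall x, V x -> U (@mul NF x (Some n)).
  move=> oU UN; exists (U `&` [set x | if x is Some m then (val n <= val m)%N
    else true]).
    split=> //; rewrite NF_openE => _.
    exact: filterI (oU UN) (free_filter_tail (val n)).
  by move=> [m|] [Um nm] //; rewrite NF_mul_maxl.
apply/mul_continuousP => -[m|] [n|] U oU Uxy.
- by exists [set Some m], [set Some n]; split=> // _ _ -> ->.
- have [V [oV VN] VU] := mulNS m U oU Uxy; exists [set Some m], V.
  by split=> // _ x -> /VU; rewrite semilattice_mulC.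
- have [V [oV VN] VU] := mulNS n U oU Uxy; exists V, [set Some n].
  by split=> // x _ + -> => /VU.
(* A product of two points is always one of the factors, so [U] is closed under multiplication. *)
- exists U, U; split=> // -[m|] [n|] // Um Un.
  have [mn|nm] := leqP (val m) (val n).
    by rewrite semilattice_mulC NF_mul_maxl.
  by rewrite NF_mul_maxl // ltnW.
Qed.

End Filter.

(** * The semilattice E as a closed topological subsemilattice *)

Section E.
Variables (F : pfilter_on posnat) (A : set posnat) (L : choiceType).
Hypotheses (F_free : free_filter F) (FA : F A).
Local Notation E := (E_type F A L).

Lemma Elam_discrete : discrete_space (Elam L).
Proof. by move=> U; exact: discrete_open. Qed.

Lemma E_openP (U : set E) :
  open U <-> exists2 V : set (NFmax F * Elam L), open V & val @^-1` V = U.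
Proof. by []. Qed.

Lemma E_valM (x y : E) : val (x * y) = val x * val y :> NFmax F * Elam L.
Proof. by []. Qed.

Lemma E_topological_semigroup : topological_semigroup E.
Proof.
have [/hausdorff_openP hP /mul_continuousP cP] :=
  prod_topological_semigroup (NF_topological_semigroup F_free)
    (discrete_topological_semigroup Elam_discrete).
split.
  apply/hausdorff_openP => x y xy.
  have /hP[U [V [oU oV Ux Vy UV]]] : val x <> val y by move=> /val_inj.
  exists (val @^-1` U), (val @^-1` V); split=> //.
  - by apply/E_openP; exists U.
  - by apply/E_openP; exists V.
  - by rewrite -preimage_setI UV preimage_set0.
apply/mul_continuousP => x y _ /E_openP[U oU <-] /= Uxy.
have [V [W [oV oW Vx Wy VW]]] := cP _ _ _ oU Uxy.
exists (val @^-1` V), (val @^-1` W); split=> //.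
- by apply/E_openP; exists V.
- by apply/E_openP; exists W.
- by move=> a b /= Va Wb; exact: VW.
Qed.

(** The complement consists of the pairs with nonzero second coordinate whose first coordinate is in
    [A] or is the limit point; the latter set is open because [A] belongs to [F]. *)
Lemma E_closed : closed (E_set F A L).
Proof.
pose V : set (NFmax F) := [set x | if x is Some n then A n else True].
have oV : open V by rewrite NF_openE.
rewrite (_ : E_set _ _ _ = ~` (V `*` ~` [set None])).
  by apply: open_closedC; apply: open_setX => //; exact: Elam_discrete.
rewrite eqEsubset; split=> [[x a]|[x [l|]]].
- by move=> [[_ /= ->] [_ []//]|[[n nA /= <-] _] [/= /nA]].
- move=> H; case: x H => [n H|[]]; last by split.
  by right; split=> /=; [exists n => // An; apply: H|exists l].
- by left.
Qed.

End E.

(** * Completeness of E under embeddings *)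

Lemma closure_setD1 (X : topologicalType) (B : set X) (x c : X) :
  hausdorff_space X -> x <> c -> closure B x -> closure (B `\ c) x.
Proof.
move=> /hausdorff_openP hX /hX[U [V [oU oV Ux Vc UV]]] clx.
apply/closureP => W oW Wx.
have [b Bb [Wb Ub]] := (closureP B x).1 clx _ (openI oW oU) (conj Wx Ux).
exists b => //; split=> // bc; suff: (U `&` V) b by rewrite UV.
by split=> //; rewrite bc.
Qed.

Section E.
Variables (F : pfilter_on posnat) (A : set posnat) (L : choiceType).
Hypotheses (F_free : free_filter F) (FA : F A).
Local Notation E := (E_type F A L).

Lemma E_open_fst (V : set (NFmax F)) : open V -> open [set e : E | V (val e).1].
Proof.
move=> oV; apply/E_openP; exists (V `*` setT).
  by apply: open_setX => //; exact: openT.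
by rewrite eqEsubset; split=> e // [].
Qed.

Lemma E_open_snd (W : set (Elam L)) : open [set e : E | W (val e).2].
Proof.
apply/E_openP; exists (setT `*` W).
  by apply: open_setX; [exact: openT|exact: Elam_discrete].
by rewrite eqEsubset; split=> e // [].
Qed.

Lemma base_subproof (x : NFmax F) :
  ((x, None) : NFmax F * Elam L) \in E_set F A L.
Proof. by apply/mem_set; left. Qed.

Definition E_base (x : NFmax F) : E :=
  exist (fun p => p \in E_set F A L) (x, None) (base_subproof x).

Lemma E_snd_Some (e : E) l :
  (val e).2 = Some l -> exists2 m, ~ A m & (val e).1 = Some m.
Proof.
by have [[_ /= ->]|[[m /= Am <-] _] _] := set_mem (valP e); last exists m.
Qed.

(** One layer of E from [n] on; for [a = None] the limit point of the base layer is left out. *)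
Definition chain_tail (a : Elam L) (n : nat) : set E :=
  [set e | (val e).2 = a /\ exists2 m, (val e).1 = Some m & (n <= val m)%N].

Lemma closure_base_None n : closure (chain_tail None n) (E_base None).
Proof.
apply/closureP => U /E_openP[V oV <-] /=.
move: oV => /prod_openP oV /oV[W [W' [oW _ WN W'N WV]]].
have [m [Wm nm]] : exists m, W (Some m) /\ (n <= val m)%N.
  exact: filter_ex (filterI (oW WN) (free_filter_tail F_free n)).
by exists (E_base (Some m)); [split=> //; exists m|exact: WV].
Qed.

Section Embedding.
Variables (Y : preTopologicalSemigroupType) (f : E -> Y).
Hypotheses (tY : topological_semigroup Y) (fM : {morph f : x y / x * y})
  (f_emb : topological_embedding f).

(** A layer has at most one point with first coordinate [n]. As [y] is not in the image, discarding
    the images of finitely many such points keeps [y] in the closure. *)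
Lemma closure_chain_tail (a : Elam L) (y : Y) n :
  ~ range f y -> closure (f @` chain_tail a 0) y ->
  closure (f @` chain_tail a n) y.
Proof.
move=> Ny cl0; elim: n => // n IH.
have [[e [ea [m em mn]]]|Ne] := EM (exists e : E, (val e).2 = a /\
    exists2 m, (val e).1 = Some m & val m = n).
  have ye : y <> f e by move=> ye; apply: Ny; exists e.
  apply: closure_subset (closure_setD1 tY.1 ye IH).
  move=> _ [[e' [ea' [m' em' nm']] <-] ee']; exists e' => //; split=> //.
  exists m' => //; rewrite ltn_neqAle nm' andbT; apply/eqP => nm; apply: ee'.
  congr f; apply: val_inj; move: ea em ea' em'.
  case: (val e) (val e') => [x b] [x' b'] /= -> -> -> ->.
  by congr (Some _, _); apply: val_inj; rewrite mn nm.
apply: closure_subset IH => _ [e [ea [m em nm]] <-]; exists e => //; split=> //.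
exists m => //; rewrite ltn_neqAle nm andbT; apply/eqP => mn; apply: Ne.
by exists e; split=> //; exists m.
Qed.

Lemma closure_base_range (y : Y) :
  closure (f @` [set e | (val e).2 = None]) y -> range f y.
Proof.
move=> cly; apply: contrapT => Ny.
pose w := f (E_base None).
have yw : y <> w by move=> yw; apply: Ny; rewrite yw; exists (E_base None).
(* Discarding [w] leaves just the base points with an integer first coordinate. *)
have cl0 : closure (f @` chain_tail None 0) y.
  apply: closure_subset (closure_setD1 tY.1 yw cly).
  move=> _ [[e /= eN <-] ew]; exists e => //; split=> //.
  case e1: (val e).1 => [m|]; first by exists m.
  case: ew; congr f; apply: val_inj => /=.
  by rewrite (surjective_pairing (val e)) e1 eN.
(* Right multiplication by (n, 0) is the identity on the base layer from [n] on, and [y] is a limit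
   of that tail. *)
have yS (n : posnat) : y * f (E_base (Some n)) = y.
  apply: (@hausdorff_equalizer _ _ (fun u : Y => u * f (E_base (Some n))) id _ _
    tY.1 (mulr_continuous tY _) _ _ (closure_chain_tail (val n) Ny cl0)).
    by move=> u; exact: cvg_id.
  move=> _ [e [eN [m em nm]] <-]; rewrite -fM; congr f; apply: val_inj.
  rewrite E_valM (surjective_pairing (val e)) em eN.
  by congr (_, _); exact: NF_mul_maxl.
have clw : closure (f @` chain_tail None 0) w.
  apply: (closure_image _ _ (closure_base_None 0)); first by case: f_emb.
  by move=> e; exists e.
have ywy : y * w = y.
  apply: (@hausdorff_equalizer _ _ (fun u : Y => y * u) (fun=> y) _ _
    tY.1 (mull_continuous tY _) _ _ clw).
    exact: cst_continuous.
  move=> _ [e [eN [m em _]] <-]; rewrite (_ : e = E_base (Some m)) //.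
  by apply: val_inj => /=; rewrite (surjective_pairing (val e)) em eN.
(* The point (F, 0) absorbs the whole base layer. *)
have yww : y * w = w.
  apply: (@hausdorff_equalizer _ _ (fun u : Y => u * w) (fun=> w) _ _
    tY.1 (mulr_continuous tY _) _ _ cly).
    exact: cst_continuous.
  move=> _ [e /= eN <-]; rewrite -fM; congr f; apply: val_inj.
  rewrite E_valM (surjective_pairing (val e)) eN.
  by congr (_, _); case: (val e).1.
by apply: yw; rewrite -ywy.
Qed.

Lemma closure_chain_range (l : L) (y : Y) :
  closure (f @` chain_tail (Some l) 0) y -> range f y.
Proof.
move=> cl0; apply: contrapT => Ny.
(* Since 1 is neutral for max, multiplying by (1, 0) sends (m, l) to (m, 0), which carries tails of
   the layer into the sets [D n]. *)
pose one : posnat := exist _ 1%N isT.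
pose D n : set E := [set e | (val e).2 = None /\
  exists2 m, (val e).1 = Some m & (n <= val m)%N /\ ~ A m].
have clD n : closure (f @` D n) (y * f (E_base (Some one))).
  apply: (closure_image (mulr_continuous tY _) _
    (closure_chain_tail (n) Ny cl0)).
  move=> _ [e [el [m em nm]] <-]; rewrite -fM; exists (e * E_base (Some one)) => //.
  have [m' Am' em'] := E_snd_Some el.
  have mE : m = m' by apply: Some_inj; rewrite -em -em'.
  have vE : val (e * E_base (Some one)) = (Some m, None) :> NFmax F * Elam L.
    rewrite E_valM (surjective_pairing (val e)) el em.
    by congr (_, _); apply: NF_mul_maxl; exact: (valP m).
  by split; rewrite vE //; exists m => //; split=> //; rewrite mE.
have [e _ fe] : range f (y * f (E_base (Some one))).
  apply: closure_base_range; apply: closure_subset (clD 0).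
  by move=> _ [e [eN _] <-]; exists e.
have cle n : closure (D n) e by apply: (embedding_closure f_emb); rewrite fe.
case e1 : (val e).1 => [p|].
  (* A base point over the integer [p] has a neighbourhood missing [D p.+1]. *)
  have op : open [set e : E | [set Some p] (val e).1].
    by apply: E_open_fst; rewrite NF_openE.
  have [e' [_ [m + [pm _]]]] := (closureP _ _).1 (cle (val p).+1) _ op e1.
  by rewrite /= => -> /Some_inj mp; rewrite mp ltnn in pm.
(* If the limit is (F, 0), then [A] with the limit point gives a neighbourhood missing [D 0]
   altogether. *)
have oA : open [set e : E | [set x | if x is Some n then A n else True]
    (val e).1].
  by apply: E_open_fst; rewrite NF_openE.
have [|e' [_ [m em [_ Am]]]] := (closureP _ _).1 (cle 0) _ oA.
  by rewrite /= e1.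
by rewrite /= em.
Qed.

Lemma E_embedding_closed : closed (range f).
Proof.
move=> y cly; apply: contrapT => Ny.
have Nl l : ~ closure (f @` chain_tail (Some l) 0) y.
  by move=> /closure_chain_range.
apply: Ny; apply: closure_base_range; apply/closureP => U oU Uy.
have yy : y * y = y.
  apply: (@hausdorff_equalizer _ _ (fun u : Y => u * u) id _ _
    tY.1 (sqr_continuous tY) _ _ cly).
    by move=> u; exact: cvg_id.
  by move=> _ [e _ <-]; rewrite -fM semilattice_mulxx.
have Uyy : U (y * y) by rewrite yy.
have [V [W [oV oW Vy Wy VWU]]] := (mul_continuousP Y).1 tY.2 _ _ U oU Uyy.
have [_ [e _ <-] [Ue Ve]] := (closureP _ _).1 cly _ (openI oU oV) (conj Uy Vy).
case el : (val e).2 => [l|]; last by exists (f e) => //; exists e.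
(* The second point is taken outside the closure of the layer of the first. Either it lies in the
   base layer, or the labels differ and the product falls into the base layer. *)
have oC : open (~` closure (f @` chain_tail (Some l) 0)).
  by apply: closed_openC; exact: closed_closure.
have [_ [e' _ <-] [[Ue' We'] Ce']] := (closureP _ _).1 cly _
  (openI (openI oU oW) oC) (conj (conj Uy Wy) (Nl l)).
case el' : (val e').2 => [l'|]; last by exists (f e') => //; exists e'.
exists (f e * f e'); last exact: VWU.
rewrite -fM; exists (e * e') => //.
rewrite /mkset E_valM (surjective_pairing (val e)) (surjective_pairing (val e')).
rewrite el el' -[LHS]/(Elam_mul (Some l) (Some l')) /Elam_mul.
case: eqP => // -[ll'].
case: Ce'; apply: subset_closure; exists e' => //.
have [m _ em] := E_snd_Some el'.
by split; [rewrite el' ll'|exists m].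
Qed.

End Embedding.

Lemma E_H_complete : H_complete E.
Proof. by move=> Y tY f fM f_emb; exact: E_embedding_closed. Qed.

End E.

Lemma infinite_posnat_unbounded (B : set posnat) n :
  infinite_set B -> exists2 m, B m & (n <= val m)%N.
Proof.
move=> infB; apply: contrapT => H; apply: infB.
apply: (@sub_finite_set _ _ (val @^-1` `I_n)).
  by move=> m Bm /=; rewrite ltnNge; apply/negP => nm; apply: H; exists m.
by apply: finite_preimage (finite_II n) => x y _ _; exact: val_inj.
Qed.

(** * The ideals of E and their Rees quotients *)

Section Quotient.
Variables (F : pfilter_on posnat) (A : set posnat) (L : choiceType) (K : set L).
Local Notation E := (E_type F A L).
Local Notation I := (I_set F A L K).

(** Inside E a nonzero second coordinate already forces the first one to be an integer outside [A],
    so the ideal depends on the second coordinate only. *)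
Lemma I_setE (e : E) : I e <-> (None |` (Some @` K)) (val e).2.
Proof.
split=> [[[_ /= ->]|[_ ?]]|[eN|[k Kk ek]]]; [by left|by right| |].
  by left.
have [m Am em] := E_snd_Some (esym ek).
by right; split; [exists m|exists k].
Qed.

Lemma I_set_open : open I.
Proof.
rewrite (_ : I = [set e : E | (None |` (Some @` K)) (val e).2]).
  exact: E_open_snd.
by rewrite eqEsubset; split=> e /I_setE.
Qed.

Lemma I_set_closed : closed I.
Proof.
rewrite -[I]setCK; apply: open_closedC.
rewrite (_ : ~` I = [set e : E | (~` (None |` (Some @` K))) (val e).2]).
  exact: E_open_snd.
by rewrite eqEsubset; split=> e Ne /I_setE.
Qed.

Lemma I_set_ideal : ideal I.
Proof.
split; first by exists (E_base A L None); left.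
move=> x y /I_setE Ix; apply/I_setE; rewrite E_valM.
rewrite -[X in (_ |` _) X]/(Elam_mul (val x).2 (val y).2) /Elam_mul.
by case: eqP => // _; left.
Qed.

Local Notation Q := (rees_quotient I_set_ideal).

Lemma pi_I (x y : E) : I x -> I y -> \pi_Q x = \pi_Q y.
Proof.
by move=> Ix Iy; apply/rees_piP; rewrite /rees_rel !mem_set // orbT.
Qed.

Lemma repr_piP (x : E) : repr (\pi_Q x) = x \/ I (repr (\pi_Q x)) /\ I x.
Proof.
have /rees_piP/orP[/eqP|/andP[/set_mem ? /set_mem ?]] :
  \pi_Q (repr (\pi_Q x)) = \pi_Q x by rewrite reprK.
  by left.
by right.
Qed.

(** The open set [I] collapses to one point, and points outside [I] are isolated in E: both their
    coordinates are isolated. *)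
Lemma Q_discrete : discrete_space Q.
Proof.
move=> U; rewrite -[open U]/(open (\pi_Q @^-1` U)) openE => e Ue.
rewrite /interior nbhsE; have [Ie|Ne] := EM (I e).
  exists I; first by split=> //; exact: I_set_open.
  by move=> x Ix; rewrite /preimage /= (pi_I Ix Ie).
case el : (val e).2 => [l|]; last by case: Ne; apply/I_setE; rewrite el; left.
have [m Am em] := E_snd_Some el.
exists ([set x : E | [set Some m] (val x).1] `&`
        [set x : E | [set Some l] (val x).2]).
  split=> //; apply: openI; last exact: E_open_snd.
  by apply: E_open_fst; rewrite NF_openE.
move=> x [/= xm xl]; rewrite /preimage /= (_ : x = e) //.
by apply: val_inj; rewrite (surjective_pairing (val x)) xm xl -em -el -surjective_pairing.
Qed.

Section Chain.
Variable l : L.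
Hypotheses (A_coinfinite : infinite_set (~` A)) (Kl : ~ K l).

(** The default 0 at the limit point never occurs on the chain, whose first coordinates are
    integers. *)
Definition E_rank (e : E) : nat := if (val e).1 is Some m then val m else 0%N.

(** [repr] can change a point only within [I], which misses layer [l] because [l] is not in [K]. *)
Lemma repr_pi_snd (e : E) :
  (val (repr (\pi_Q e))).2 = Some l <-> (val e).2 = Some l.
Proof.
have NI (x : E) : I x -> (val x).2 <> Some l.
  by move=> /I_setE + xl; rewrite xl => -[|[k Kk [kl]]] //; rewrite kl in Kk.
by have [->|[Ir Ie]] := repr_piP e; split=> // /NI.
Qed.

Lemma Elam_mul_Some (x y : Elam L) :
  Elam_mul x y = Some l <-> x = Some l /\ y = Some l.
Proof.
rewrite /Elam_mul; split; last by move=> [-> ->]; rewrite eqxx.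
by case: eqP => // ->.
Qed.

(** The chain is layer [l], ordered by max, and [z] is the class of the ideal. Primality holds
    because a product in [Elam L] equals [l] only if both factors do; unboundedness comes from the
    infinite complement of [A]. *)
Lemma rees_prime_chain : prime_chain
  [set q : Q | (val (repr q)).2 = Some l] (fun q : Q => E_rank (repr q))
  (\pi_Q (E_base A L None)).
Proof.
have I0 : I (E_base A L None) by left.
have mulE (a b : Q) : a * b = \pi_Q (repr a * repr b) by [].
split=> /=.
- move=> a b; rewrite mulE repr_pi_snd E_valM; exact: Elam_mul_Some.
- move=> a b al bl; have [m _ am] := E_snd_Some al.
  have [n _ bn] := E_snd_Some bl; rewrite /E_rank am bn => mn.
  suff ba : repr b * repr a = repr b by rewrite mulE semilattice_mulC ba reprK.
  apply: val_inj; rewrite E_valM (surjective_pairing (val (repr b))).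
  rewrite (surjective_pairing (val (repr a))) am bn al bl.
  congr (_, _); first exact: NF_mul_maxl.
  exact: semilattice_mulxx.
- move=> a b al bl; rewrite mulE; apply: pi_I => //.
  apply/I_setE; rewrite E_valM; left.
  rewrite -[_ _]/(Elam_mul (val (repr a)).2 (val (repr b)).2 = None) /Elam_mul.
  by case: eqP => // ab; case: bl; rewrite -ab.
- by move=> /repr_pi_snd.
- move=> a; rewrite -[a]reprK -[LHS]/(rees_mul _ _) rees_mul_pi.
  apply: pi_I => //; rewrite semilattice_mulC.
  exact: I_set_ideal.2.
- move=> n; have [m Am nm] := infinite_posnat_unbounded n A_coinfinite.
  have Em : ((Some m, Some l) : NFmax F * Elam L) \in E_set F A L.
    by apply/mem_set; right; split; [exists m|exists l].
  pose e : E := exist (fun p => p \in E_set F A L) _ Em.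
  have re : repr (\pi_Q e) = e.
    have [//|[_ /I_setE[|[k Kk [kl]]]]] := repr_piP e => //.
    by rewrite kl in Kk.
  by exists (\pi_Q e) => //=; rewrite re.
Qed.

End Chain.

Lemma rees_not_closed (A_coinfinite : infinite_set (~` A)) :
  K `<` [set: L] ->
  exists Y : preTopologicalSemigroupType, topological_semigroup Y /\
    exists f : Q -> Y, [/\ {morph f : x y / x * y}, topological_embedding f &
      ~ closed (range f)].
Proof.
move=> [_ TK]; have [l Kl] : exists l, ~ K l.
  by apply/existsNP => KT; apply: TK => l _.
exact: prime_chain_not_closed Q_discrete (rees_prime_chain A_coinfinite Kl).
Qed.

End Quotient.

Theorem theorem9 (F : pfilter_on posnat) (F_free : free_filter F)
    (A : set posnat) (FA : F A) (A_coinfinite : infinite_set (~` A))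
    (L : choiceType) (L_infinite : infinite_set [set: L]) :
  [/\ (* (i) *)
      [/\ closed (E_set F A L),
          topological_semigroup (E_type F A L) &
          H_complete (E_type F A L)],
      (* (ii) *)
      forall K : set L, K `<` [set: L] ->
        exists idK : ideal (I_set F A L K),
          [/\ open (I_set F A L K), closed (I_set F A L K),
              discrete_space (rees_quotient idK),
              topological_semigroup (rees_quotient idK) &
              ~ H_complete (rees_quotient idK)] &
      (* (iii) *)
      ~ AH_complete (E_type F A L)].
Proof.
split.
- split; [exact: E_closed|exact: E_topological_semigroup|exact: E_H_complete].
- move=> K KL; exists (I_set_ideal F A K); split.
  + exact: I_set_open.
  + exact: I_set_closed.
  + exact: Q_discrete.
  + exact: discrete_topological_semigroup (@Q_discrete _ _ _ _).
  + have [Y [tY [f [fM femb Ncl]]]] := rees_not_closed F A_coinfinite KL.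
    by move=> H; apply: Ncl; exact: H.
(* An infinite [L] is nonempty, so the empty set is a proper subset and the quotient by the base
   layer is available. *)
- move=> H; have L0 : set0 `<` [set: L].
    split=> // T0; apply: L_infinite; exact: sub_finite_set T0 (finite_set0 _).
  have [Y [tY [f [fM [_ cf _] Ncl]]]] := rees_not_closed F A_coinfinite L0.
  apply: Ncl; set Q := rees_quotient _ in f fM cf *.
  (* The projection is onto, so the composite has the same non-closed image. *)
  have -> : range f = range (f \o \pi_Q).
    rewrite eqEsubset; split=> _ [x _ <-]; last by exists (\pi_Q x).
    by exists (repr x) => //=; rewrite reprK.
  apply: (H Y tY).
    by move=> x y /=; rewrite -fM; congr f; rewrite -[RHS]/(rees_mul _ _) rees_mul_pi.
  move=> x; apply: continuous_comp; last exact: cf.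
  exact: pi_continuous.
Qed.
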